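(* Let $X^{\mathrm{in}}\subseteq\mathbb{R}^d$ be nonempty, let $T:\mathbb{R}^d\to\mathbb{R}^d$ be a nonzero map, and let $\varphi:\mathbb{R}^d\to\mathbb{R}$ satisfy $\varphi(0)=0$. For $k\in\mathbb{N}$ let $\nu_k:=\sup\{\varphi(T^k(x)) : x\in X^{\mathrm{in}}\}$, and assume that $\nu_k$ is finite for every $k\in\mathbb{N}$; write $\nu=(\nu_k)_{k\in\mathbb{N}}$. Assume that there exist $\gamma\in\mathcal{KL}$ and a nonnegative function $\psi:\mathbb{R}^d\to\mathbb{R}$ with $0<\sup_{x\in X^{\mathrm{in}}}\psi(x)<+\infty$ such that for all $x\in X^{\mathrm{in}}$ and all $k\in\mathbb{N}$, $$\varphi(T^k(x))\leq \gamma(\psi(x),k).$$ Then: 1. $\limsup_{n\to+\infty}\nu_n\leq 0$; and if, moreover, there exist $k\in\mathbb{N}$ and $x\in X^{\mathrm{in}}$ with $\varphi(T^k(x))>0$, then the set $\{k\in\mathbb{N} : \nu_k>\limsup_{n\to+\infty}\nu_n\}$ is nonempty. 2. There exists $h\in\mathcal{K}_\infty$ such that $(h,e^{-1})\in\Gamma(\nu)$; and if, moreover, there exist $k\in\mathbb{N}$ and $x\in X^{\mathrm{in}}$ with $\varphi(T^k(x))>0$, then $h$ is useful for $\nu$.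
   Context: $\mathbb{N}$ includes $0$; $\mathbb{R}_+=[0,+\infty)$; $T^k$ is the $k$-fold composition of $T$, with $T^0=\mathrm{Id}$. Comparison functions. A function $\alpha:[0,a)\to\mathbb{R}_+$ (for some $a>0$, possibly $a=+\infty$) belongs to $\mathcal{K}$ if it is strictly increasing and continuous on $[0,a)$ and $\alpha(0)=0$; if moreover $a=+\infty$ and $\lim_{x\to+\infty}\alpha(x)=+\infty$, then $\alpha\in\mathcal{K}_\infty$. A function $\sigma:\mathbb{R}_+\to\mathbb{R}_+$ belongs to $\mathcal{L}$ if it is continuous, decreasing, and $\lim_{x\to+\infty}\sigma(x)=0$. A function $\gamma:\mathbb{R}_+\times\mathbb{R}_+\to\mathbb{R}_+$ belongs to $\mathcal{KL}$ if for all $t\in\mathbb{R}_+$ the map $s\mapsto\gamma(s,t)$ belongs to $\mathcal{K}$, and for all $s\in\mathbb{R}_+$ the map $t\mapsto\gamma(s,t)$ belongs to $\mathcal{L}$. Upper-bounding pairs. $\Omega([0,1])$ is the set of functions $h:\mathbb{R}\to\mathbb{R}$ that are strictly increasing and continuous on $[0,1]$; such a function may be given only on a set containing $[0,1]$ (e.g. $\mathbb{R}_+$), its extension to $\mathbb{R}$ being arbitrary. For a real sequence $u=(u_k)_{k\in\mathbb{N}}$, $\Gamma(u):=\{(h,\beta)\in\Omega([0,1])\times(0,1) : u_k\leq h(\beta^k)\ \forall k\in\mathbb{N}\}$. For $u$ bounded above with $\{k : u_k>\limsup_{n\to+\infty}u_n\}\neq\emptyset$, a function $h\in\Omega([0,1])$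 for which there is $\beta\in(0,1)$ with $(h,\beta)\in\Gamma(u)$ is called useful for $u$ if $\{k\in\mathbb{N} : u_k>h(0)\}\neq\emptyset$. *)

(* Defs.v *)
From HB Require Import structures.
From mathcomp Require Export all_boot all_order all_algebra.
From mathcomp Require Export all_classical all_reals all_analysis.

Set Implicit Arguments.
Unset Strict Implicit.
Unset Printing Implicit Defensive.

Import Order.TTheory GRing.Theory Num.Theory.
Import numFieldNormedType.Exports.

Local Open Scope classical_set_scope.
Local Open Scope ring_scope.

(* Functions given on an interval of R are encoded as total functions on R
   whose values outside of that interval are arbitrary: every condition below
   is relative to the interval. *)
Section Comparison.
Context {R : realType}.

Definition domK (a : \bar R) : set R := [set x : R | 0 <= x /\ (x%:E < a)%E].

Definition classK (a : \bar R) (alpha : R -> R) : Prop :=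
  [/\ (0 < a)%E,
      forall x, domK a x -> 0 <= alpha x,
      forall x y, domK a x -> domK a y -> x < y -> alpha x < alpha y,
      {within domK a, continuous alpha}
    & alpha 0 = 0].

Definition classKinf (alpha : R -> R) : Prop :=
  classK +oo%E alpha /\ alpha x @[x --> +oo] --> +oo.

(* "Decreasing" is not strict here: for gamma of class KL, the section
   t |-> gamma 0 t is identically 0 and has to be of class L. *)
Definition classL (sigma : R -> R) : Prop :=
  [/\ forall x, 0 <= x -> 0 <= sigma x,
      {within [set x : R | 0 <= x], continuous sigma},
      forall x y, 0 <= x -> x <= y -> sigma y <= sigma x
    & sigma x @[x --> +oo] --> (0 : R)].

Definition classKL (gamma : R -> R -> R) : Prop :=
  (forall t, 0 <= t -> classK +oo%E (fun s => gamma s t)) /\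
  (forall s, 0 <= s -> classL (fun t => gamma s t)).

End Comparison.

Section UpperBoundingPairs.
Context {R : realType}.

Definition Omega01 : set (R -> R) :=
  [set h : R -> R | {in `[0, 1] &, {homo h : x y / x < y}} /\
           {within `[0, 1], continuous h}].

Definition Gamma (u : nat -> R) : set ((R -> R) * R) :=
  [set hb | [/\ Omega01 hb.1, 0 < hb.2 < 1
              & forall k : nat, u k <= hb.1 (hb.2 ^+ k)]].

(* The limit superior is taken in \bar R: it may be -oo. *)
Definition above_limsup (u : nat -> R) : set nat :=
  [set k | (limn_esup (fun n => (u n)%:E) < (u k)%:E)%E].

(* The first three conditions are the ones under which usefulness is
   defined. *)
Definition useful (u : nat -> R) (h : R -> R) : Prop :=
  [/\ has_ubound (range u), above_limsup u !=set0,
      exists beta, Gamma u (h, beta)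
    & [set k | h 0 < u k] !=set0].

End UpperBoundingPairs.

Section ReachableValues.
Context {R : realType} {d : nat}.

Definition enu (T : 'rV[R]_d -> 'rV[R]_d) (phi : 'rV[R]_d -> R)
    (Xin : set 'rV[R]_d) (k : nat) : \bar R :=
  ereal_sup [set (phi (iter k T x))%:E | x in Xin].

(* Meaningful only where [enu] is finite. *)
Definition nu (T : 'rV[R]_d -> 'rV[R]_d) (phi : 'rV[R]_d -> R)
    (Xin : set 'rV[R]_d) (k : nat) : R :=
  fine (enu T phi Xin k).

End ReachableValues.

(* Main.v *)
Require Import Defs.
From mathcomp Require Import all_boot all_order all_algebra.
From mathcomp Require Import all_classical all_reals all_analysis.
Import Order.TTheory GRing.Theory Num.Theory.
Import numFieldNormedType.Exports.
Local Open Scope classical_set_scope.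
Local Open Scope ring_scope.

(** Let [S] be the supremum of [psi] over [Xin], a positive real, and let
    [sigma t := gamma S t], a function of class L.  Since [gamma] is increasing
    in its first argument, [phi (iter k T x) <= gamma (psi x) k <= sigma k] for
    all [x] in [Xin], hence [nu k <= sigma k] for all [k] ([nu_le]).  Everything
    else is a consequence of this bound by a vanishing sequence.

    The limit superior of [nu] is at most that of [sigma k], which is 0
    ([limn_esup_le0]); and if [phi (iter k T x) > 0] somewhere, then [nu k > 0]
    for this [k], which therefore lies above the limit superior.

    For the second part, the substitution [t = - ln x] turns the decay of
    [sigma] at infinity into continuity at 0: the function
    [x |-> sigma (- ln x)], extended by 0 at [x = 0] and by [sigma 0] for
    [x >= 1], is nondecreasing and continuous.  Adding [x] to it makes it
    strictly increasing and unbounded, hence of class K_infinity, and keeps it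
    above [sigma k] at [x = expR (- k)] ([classL_le_classKinf]).  It vanishes
    at 0, so that it is useful as soon as some [nu k] is positive. *)

Section MajorantOfClassL.
Context {R : realType}.
Implicit Types sigma : R -> R.

(** The truncation at 0 extends [sigma (- ln x)] by the constant [sigma 0] to
    [x >= 1]; the test [0 < x] is what gives the value 0 at 0, where the
    conventional value [ln 0 = 0] would give [sigma 0]. *)
Definition expo_profile sigma (x : R) : R :=
  if 0 < x then sigma (Num.max 0 (- ln x)) else 0.

Lemma expo_profile_ge0 sigma x : classL sigma -> 0 <= expo_profile sigma x.
Proof.
case=> sigma_ge0 _ _ _; rewrite /expo_profile; case: ifP => // _.
by apply: sigma_ge0; rewrite le_max lexx.
Qed.

Lemma expo_profile_homo sigma : classL sigma ->
  {homo expo_profile sigma : x y / x <= y}.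
Proof.
move=> sigmaL x y xy; have [_ _ sigma_anti _] := sigmaL.
have [x0|x0] := ltP 0 x; last first.
  by rewrite {1}/expo_profile ltNge x0 /= expo_profile_ge0.
have y0 : 0 < y := lt_le_trans x0 xy.
rewrite /expo_profile x0 y0; apply: sigma_anti.
  by rewrite le_max lexx.
rewrite ge_max !le_max lexx /= lerN2.
by apply/orP; right; rewrite ler_ln ?posrE.
Qed.

(** Truncating the argument turns continuity relative to the half-line into
    continuity on the whole line, so that ordinary composition applies. *)
Lemma classL_comp_max_continuous sigma : classL sigma ->
  continuous (fun t : R => sigma (Num.max 0 t)).
Proof.
move=> [_ sigma_cont _ _] t.
have max_ge0 s : [set r : R | 0 <= r] (Num.max 0 s) by rewrite /= le_max lexx.
move/subspace_continuousP: sigma_cont => /(_ _ (max_ge0 t)) sigma_t.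
have max_t : Num.max 0 s @[s --> t] -->
    within [set s : R | 0 <= s] (nbhs (Num.max 0 t)).
  move=> A /= A_nbhs.
  have : {for t, continuous ((fun _ : R => 0 : R^o) \max (id : R -> R^o))}.
    by apply: continuous_max; [exact: cvg_cst|exact: cvg_id].
  move=> /(_ _ A_nbhs) near_max.
  apply: (@filterS _ (nbhs t)) near_max => s; apply; exact: max_ge0.
exact: cvg_comp max_t sigma_t.
Qed.

(** At [x > 0] this is a composition of continuous functions.  At 0 it is the
    decay of [sigma]: [0 < x < expR (- M)] means that [- ln x > M]. *)
Lemma expo_profile_continuous sigma : classL sigma ->
  continuous (expo_profile sigma).
Proof.
move=> sigmaL x; have [_ _ _ sigma_lim] := sigmaL.
rewrite /continuous_at; have [x0|x0|->] := ltgtP x 0.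
- have -> : expo_profile sigma x = 0 by rewrite /expo_profile ltNge ltW.
  apply: cvg_near_cst; near=> y.
  by rewrite /expo_profile ifF // lt_gtF //; near: y; apply: lt_nbhsl.
- have -> : expo_profile sigma x = sigma (Num.max 0 (- ln x)).
    by rewrite /expo_profile x0.
  have near_eq : {near nbhs x,
      (fun y => sigma (Num.max 0 (- ln y))) =1 expo_profile sigma}.
    by near=> y; rewrite /expo_profile ifT //; near: y; apply: lt_nbhsr.
  apply: cvg_trans (near_eq_cvg near_eq) _.
  have ln_x : - ln y @[y --> x] --> - ln x by exact: cvgN (continuous_ln x0).
  exact: cvg_comp ln_x (classL_comp_max_continuous _ sigmaL (- ln x)).
- have -> : expo_profile sigma 0 = 0 by rewrite /expo_profile ltxx.
  apply/cvgrPdistC_lt => e e0.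
  have [M [_ sigmaM]] : \forall t \near +oo, sigma t < e.
    exact: cvgr_lt sigma_lim _ e0.
  near=> y; rewrite subr0 ger0_norm ?expo_profile_ge0 // /expo_profile.
  case: ifPn => // y0; apply: sigmaM.
  rewrite lt_max ltrNr -(@expRK R (- M)) ltr_ln ?posrE ?expR_gt0 //.
  by apply/orP; right; near: y; apply: lt_nbhsl; exact: expR_gt0.
Unshelve. all: by end_near. Qed.

(** Every decay rate of class L is, up to a K_infinity change of scale, at
    least as fast as exponential.  Continuity and monotonicity of the witness
    are asserted on the whole line, which covers at once the half-line of
    K_infinity and the segment [0, 1] of upper-bounding pairs. *)
Lemma classL_le_classKinf sigma : classL sigma ->
  exists h : R -> R,
    [/\ classKinf h, continuous h, {homo h : x y / x < y}
      & forall t, 0 <= t -> sigma t <= h (expR (- t))].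
Proof.
move=> sigmaL; pose h x := expo_profile sigma x + x; exists h.
have h_cont : continuous h.
  by move=> x; apply: cvgD; [exact: expo_profile_continuous|exact: cvg_id].
have h_incr : {homo h : x y / x < y}.
  by move=> x y xy; apply: ler_ltD => //; apply: expo_profile_homo => //; apply: ltW.
split=> //; last first.
  move=> t t0; rewrite /h /expo_profile expR_gt0 expRK opprK.
  by rewrite (max_idPr t0) lerDl expR_ge0.
split; last first.
  apply: ger_cvgy (@cvg_id _ (pinfty_nbhs R)).
  by near=> x; rewrite lerDr expo_profile_ge0.
split=> //.
- by move=> x [x0 _]; rewrite addr_ge0 ?expo_profile_ge0.
- by move=> x y _ _; apply: h_incr.
- exact: continuous_subspaceT.
- by rewrite /h /expo_profile ltxx addr0.
Unshelve. all: by end_near. Qed.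

End MajorantOfClassL.

Lemma limn_esup_le0 {R : realType} (u v : nat -> R) :
  (forall n, u n <= v n) -> v n @[n --> \oo] --> 0 ->
  (limn_esup (fun n => (u n)%:E) <= 0)%E.
Proof.
move=> uv v0; apply/lee_addgt0Pr => e e0; rewrite add0e.
have v_lt_e : \forall n \near \oo, v n < e by exact: cvgr_lt v0 _ e0.
rewrite /limn_esup limf_esupE; apply: ge_ereal_inf.
exists (ereal_sup [set (u n)%:E | n in [set n | v n < e]]).
  by exists [set n | v n < e].
apply: ge_ereal_sup => _ [n /= vn <-].
by rewrite lee_fin (le_trans (uv n)) // ltW.
Qed.

Section ReachableValuesTheory.
Context {R : realType} {d : nat}.
Variables (T : 'rV[R]_d -> 'rV[R]_d) (phi : 'rV[R]_d -> R).
Variables (Xin : set 'rV[R]_d) (k : nat).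
Hypothesis enu_fin : enu T phi Xin k \is a fin_num.

Lemma le_nu x : Xin x -> phi (iter k T x) <= nu T phi Xin k.
Proof.
move=> Xx; rewrite -lee_fin /nu fineK //.
by apply: ereal_sup_ubound; exists x.
Qed.

Lemma nu_le c : (forall x, Xin x -> phi (iter k T x) <= c) ->
  nu T phi Xin k <= c.
Proof.
move=> phi_le; rewrite -lee_fin /nu fineK //.
by apply: ge_ereal_sup => _ [x Xx <-]; rewrite lee_fin phi_le.
Qed.

End ReachableValuesTheory.

Lemma classK_homo {R : realType} (alpha : R -> R) x y :
  classK +oo%E alpha -> 0 <= x -> x <= y -> alpha x <= alpha y.
Proof.
move=> [_ _ alpha_incr _ _] x0; rewrite le_eqVlt => /predU1P[->//|xy].
apply/ltW/alpha_incr => //; split; rewrite ?ltry //.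
exact: le_trans x0 (ltW xy).
Qed.

Theorem theorem4 (R : realType) (d : nat) (Xin : set 'rV[R]_d)
    (T : 'rV[R]_d -> 'rV[R]_d) (phi : 'rV[R]_d -> R)
    (Xin_neq0 : Xin !=set0)
    (T_neq0 : T <> cst 0)
    (phi_0 : phi 0 = 0)
    (nu_fin : forall k : nat, enu T phi Xin k \is a fin_num)
    (KL_bound : exists (gamma : R -> R -> R) (psi : 'rV[R]_d -> R),
      [/\ classKL gamma,
          forall x, 0 <= psi x,
          (0 < ereal_sup [set (psi x)%:E | x in Xin] < +oo)%E
        & forall x (k : nat), Xin x ->
            phi (iter k T x) <= gamma (psi x) k%:R]) :
  ((limn_esup (fun n => (nu T phi Xin n)%:E) <= 0)%E /\
   ((exists (k : nat) x, Xin x /\ 0 < phi (iter k T x)) ->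
    above_limsup (nu T phi Xin) !=set0)) /\
  (exists h : R -> R,
    [/\ classKinf h,
        Gamma (nu T phi Xin) (h, expR (- 1))
      & (exists (k : nat) x, Xin x /\ 0 < phi (iter k T x)) ->
        useful (nu T phi Xin) h]).
Proof.
have [gamma [psi [[gammaK gammaL] psi_ge0 /andP[S_gt0 S_lty] phi_le]]] := KL_bound.
set S := ereal_sup _ in S_gt0 S_lty.
have S_fin : S \is a fin_num by rewrite ge0_fin_numE // ltW.
pose s := fine S; have s_ge0 : 0 <= s by rewrite fine_ge0 // ltW.
have psi_le x : Xin x -> psi x <= s.
  by move=> Xx; rewrite -lee_fin fineK //; apply: ereal_sup_ubound; exists x.
have sigmaL := gammaL s s_ge0.
set sigma := gamma s in sigmaL.
have nu_le_sigma k : nu T phi Xin k <= sigma k%:R.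
  apply: nu_le => // x Xx; apply: le_trans (phi_le x k Xx) _.
  by apply: (@classK_homo R (fun r => gamma r k%:R)) => //; [exact: gammaK|exact: psi_le].
have limsup_le0 : (limn_esup (fun n => (nu T phi Xin n)%:E) <= 0)%E.
  apply: (limn_esup_le0 _ _ nu_le_sigma); case: sigmaL => _ _ _ sigma0.
  exact: cvg_comp cvgr_idn sigma0.
have nu_gt0 k x : Xin x -> 0 < phi (iter k T x) -> 0 < nu T phi Xin k.
  move=> Xx phi_gt0.
  exact: lt_le_trans phi_gt0 (le_nu _ _ _ _ (nu_fin k) _ Xx).
have above_nonempty : (exists (k : nat) x, Xin x /\ 0 < phi (iter k T x)) ->
    above_limsup (nu T phi Xin) !=set0.
  move=> [k [x [Xx /(nu_gt0 _ _ Xx) nu_k_gt0]]]; exists k.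
  by apply: le_lt_trans limsup_le0 _; rewrite lte_fin.
split=> //.
have [h [hKinf h_cont h_incr sigma_le_h]] := classL_le_classKinf _ sigmaL.
have h_Gamma : Gamma (nu T phi Xin) (h, expR (- 1)).
  split=> /=.
  - by split; [move=> x y _ _; apply: h_incr|exact: continuous_subspaceT].
  - by rewrite expR_gt0 expR_lt1 oppr_lt0 ltr01.
  - move=> k; apply: le_trans (nu_le_sigma k) _.
    by rewrite -expRM_natl mulrN1; apply: sigma_le_h.
exists h; split=> // phi_pos; split.
- exists (sigma 0) => _ [k _ <-]; apply: le_trans (nu_le_sigma k) _.
  by case: sigmaL => _ _ sigma_anti _; apply: sigma_anti.
- exact: above_nonempty.
- by exists (expR (- 1)).
- have [[_ _ _ _ h0] _] := hKinf.
  have [k [x [Xx /(nu_gt0 _ _ Xx) nu_k_gt0]]] := phi_pos.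
  by exists k; rewrite /= h0.
Qed.
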